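(* Let $\alpha,D>0$ and let $A(t,t_p)$ be a time-base generator with (B1)–(B3), i.e. the system $\dot V=-A(t,t_p)V$ has evolution operator $\Phi$ with $\|\Phi(t,\tau)\|\le\mu_{\alpha,D}(t,\tau)$ for all $t\ge\tau\ge0$, where $\mu_{\alpha,D}$ satisfies (B1)–(B3). Consider the system $\dot x(t)=-A(t,t_p)f(x(t))$ with equilibrium $x^*=0$. Suppose there exists a Lyapunov function $V(x)$ with $V(x)\ge c\|x\|^2$ for some $c>0$ such that along the trajectories of this system $$\dot V(x(t))=-A(t,t_p)V(x(t))+F(t,V(x(t))),$$ where $F$ is continuous and $\|F(t,V(x(t)))\|\le\widehat M$ for some $\widehat M>0$. Then the system $\dot x(t)=-A(t,t_p)f(x(t))$ achieves predefined-time approximate convergence to a bounded neighborhood of $x^*$ at $t_p$.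
   Context: Here $t_p>0$, $\|\cdot\|$ is the Euclidean norm, $V$ is real valued, $A(t,t_p)$ is a real-valued function of $t\ge0$, and the evolution operator $\Phi(t,\tau)$ of $\dot V=-A(t,t_p)V$ is defined by $V(t)=\Phi(t,\tau)V(\tau)$ for all solutions. Conditions on the positive function $\mu_{\alpha,D}(t,\tau)$: (B1) $\lim_{t\to+\infty}\mu_{\alpha,D}(t,\tau)=0$, and $\mu_{\alpha,D}(t,\tau)$ is decreasing in $t$ and in $\alpha$ and increasing in $D$; (B2) $\alpha$ is sufficiently large that $\lim_{t\to t_p^+}\mu_{\alpha,D}(t,0)\le\epsilon$, where $\epsilon>0$ is small; (B3) with $\mu(t,\tau):=\mu_{1,1}(t,\tau)$, one has $\mu_{\alpha,D}(t,\tau)=D\,\mu^{\alpha}(t,\tau)$, $\mu(t,\tau)\mu(\tau,s)=\mu(t,s)$, and $\frac{\partial\mu(0,t)}{\partial t}\cdot\mu^{-1}(0,t)\ge1$. Predefined-time approximate convergence to a bounded neighborhood of $x^*$ at $t_p$ means: there is a bounded neighborhood $\mathcal N$ of $x^*$, not depending on $x(0)$, such that for every $x(0)$: 1) $\limsup_{t\to t_p^+}\mathrm{dist}(x(t),\mathcal N)\le\epsilon$ with $0<\epsilon=\epsilon(x(0))\ll1$; 2) $\mathrm{dist}(x(t),\mathcal N)\le\epsilon$ for all $t\ge t_p$; 3) $\lim_{t\to\infty}\mathrm{dist}(x(t),\mathcal N)=0$. Here ''$\epsilon\ll1$'' means that, for given $x(0)$, any prescribed $\epsilon>0$ is attained when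 the TBG parameter $\alpha$ is taken sufficiently large. *)

(* Defs.v *)
From HB Require Import structures.
From mathcomp Require Import all_boot all_order all_algebra.
From mathcomp Require Import all_classical all_reals all_analysis.

Set Implicit Arguments.
Unset Strict Implicit.
Unset Printing Implicit Defensive.

Import Order.TTheory GRing.Theory Num.Theory.
Import numFieldNormedType.Exports.

Local Open Scope classical_set_scope.
Local Open Scope ring_scope.

(* The library norm on row vectors is the sup norm. *)
Definition enorm (R : realType) (n : nat) (x : 'rV[R]_n) : R :=
  Num.sqrt (\sum_(i < n) x 0 i ^+ 2).

Definition dist (R : realType) (n : nat) (x : 'rV[R]_n) (N : set 'rV[R]_n) : R :=
  inf [set enorm (x - y) | y in N].

(* Classical solutions of v' = g(t, v) on [0, +oo[: continuous at the initial
   time, differentiable with the prescribed derivative at every t > 0.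
   Values of v at negative times play no role. *)
Definition solves (R : realType) (W : normedModType R)
    (g : R -> W -> W) (v : R -> W) : Prop :=
  v t @[t --> 0^'+] --> v 0 /\
  (forall t : R, 0 < t -> is_derive t (1 : R) v (g t (v t))).

(* Evolution operator of the scalar equation v' = - a(t) v. Without the first
   clause, Phi would be unconstrained when v' = - a(t) v has few solutions; no
   regularity of a is required beyond what that clause entails. *)
Definition evolution_operator (R : realType) (a : R -> R) (Phi : R -> R -> R)
    : Prop :=
  (forall tau v0 : R, 0 <= tau ->
     exists v : R -> R, solves (fun t y => - a t * y) v /\ v tau = v0) /\
  (forall v : R -> R, solves (fun t y => - a t * y) v ->
     forall t tau : R, 0 <= t -> 0 <= tau -> v t = Phi t tau * v tau).

(* In B1, B2, B3, [mu alpha D t tau] stands for mu_{alpha,D}(t, tau). *)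

(* Monotonicity in alpha is only meaningful for t >= tau: by (B3),
   mu_{alpha,D} = D mu^alpha, and mu(t, tau) <= 1 exactly for t >= tau. *)
Definition B1 (R : realType) (mu : R -> R -> R -> R -> R) : Prop :=
  [/\ forall alpha D tau : R, 0 < alpha -> 0 < D -> 0 <= tau ->
        mu alpha D t tau @[t --> +oo] --> (0 : R),
      forall alpha D t t' tau : R, 0 < alpha -> 0 < D -> 0 <= tau ->
        0 <= t -> t <= t' -> mu alpha D t' tau <= mu alpha D t tau,
      forall alpha alpha' D t tau : R, 0 < alpha -> alpha <= alpha' -> 0 < D ->
        0 <= tau -> tau <= t -> mu alpha' D t tau <= mu alpha D t tau
    & forall alpha D D' t tau : R, 0 < alpha -> 0 < D -> D <= D' ->
        0 <= tau -> 0 <= t -> mu alpha D t tau <= mu alpha D' t tau].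

Definition B2 (R : realType) (tp : R) (mu : R -> R -> R -> R -> R)
    (alpha D eps : R) : Prop :=
  exists l : R, mu alpha D t 0 @[t --> tp^'+] --> l /\ l <= eps.

Definition B3 (R : realType) (mu : R -> R -> R -> R -> R) : Prop :=
  [/\ forall alpha D t tau : R, 0 < alpha -> 0 < D -> 0 <= t -> 0 <= tau ->
        mu alpha D t tau = D * mu 1 1 t tau `^ alpha,
      forall t tau s : R, 0 <= t -> 0 <= tau -> 0 <= s ->
        mu 1 1 t tau * mu 1 1 tau s = mu 1 1 t s
    & forall t : R, 0 < t ->
        derivable (mu 1 1 0) t 1 /\
        1 <= derive1 (mu 1 1 0) t * (mu 1 1 0 t)^-1].

Definition approximately_converges (R : realType) (n : nat) (tp : R)
    (N : set 'rV[R]_n) (eps : R) (x : R -> 'rV[R]_n) : Prop :=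
  [/\ (limf_esup (fun t => (dist (x t) N)%:E) tp^'+ <= eps%:E)%E,
      forall t : R, tp <= t -> dist (x t) N <= eps
    & dist (x t) N @[t --> +oo] --> (0 : R)].

(* [P] is a set of generator parameters and [g alpha] the right-hand side of
   the system with parameter alpha. One neighbourhood N serves all initial
   states and all alpha in P. [eps alpha x0] is the accuracy reached from x0
   with parameter alpha; "eps << 1" is its convergence to 0 as alpha grows. *)
Definition predefined_time_approx_convergence (R : realType) (n : nat)
    (tp : R) (xstar : 'rV[R]_n) (P : set R)
    (g : R -> R -> 'rV[R]_n -> 'rV[R]_n) (eps : R -> 'rV[R]_n -> R) : Prop :=
  exists N : set 'rV[R]_n,
    [/\ bounded_set N,
        nbhs xstar N
      & forall x0 : 'rV[R]_n,
          [/\ forall alpha, P alpha -> 0 < eps alpha x0,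
              eps alpha x0 @[alpha --> +oo] --> (0 : R)
            & forall alpha (x : R -> 'rV[R]_n),
                P alpha -> solves (g alpha) x -> x 0 = x0 ->
                approximately_converges tp N (eps alpha x0) x]].

(* Main.v *)
Require Import Defs.
From HB Require Import structures.
From mathcomp Require Import all_boot all_order all_algebra.
From mathcomp Require Import all_classical all_reals all_analysis.
From mathcomp Require Import ring lra.

Set Implicit Arguments.
Unset Strict Implicit.
Unset Printing Implicit Defensive.

Import Order.TTheory GRing.Theory Num.Theory.
Import numFieldNormedType.Exports.

Local Open Scope classical_set_scope.
Local Open Scope ring_scope.

(** Write m(t) for mu_{1,1}(0,t). By the cocycle identity the bound on the
    evolution operator reads |Phi(t,tau)| <= D (m(tau)/m(t))^alpha. Variation
    of constants expresses w = V o x as Phi(t,0) w(0) plus the integral over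
    [0,t] of Phi(t,tau) F(tau,w(tau)), and the condition m' >= m makes
    D M (m(tau)/m(t))^alpha at most the tau-derivative of
    (D M / alpha) (m(tau)/m(t))^alpha. Hence the integral is at most
    D M / alpha, uniformly in t, and
      V(x(t)) <= mu_{alpha,D}(t,0) V(x(0)) + D M / alpha.
    No integral is formed: the increments of tau |-> Phi(t,tau) w(tau) are
    compared with those of the second function by the mean value theorem; this
    is [perturbed_solution_le].

    If M <= K alpha, the last term is at most D K, so V(x) >= c |x|^2 places
    x(t) within sqrt (mu_{alpha,D}(t,0) (V(x(0)) + 1) / c) of the Euclidean
    ball N of radius sqrt (D K / c), which depends neither on x(0) nor on
    alpha. This distance bound is nonincreasing in t and tends to 0 at
    infinity; its value at tp is the accuracy eps. A single alpha always admits
    K = M(alpha) / alpha. Finally m' >= m and m >= 1 force m(tp) > 1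
    ([gauge_lt1]), so mu_{alpha,D}(tp,0) = D m(tp)^(-alpha), and eps with it,
    tends to 0 as alpha grows. *)

(** * The perturbed scalar equation *)

Lemma le_increment (R : realType) (h dh G dG : R -> R) (s t : R) : s < t ->
  (forall u : R, s <= u <= t -> is_derive u 1 h (dh u)) ->
  (forall u : R, s <= u <= t -> is_derive u 1 G (dG u)) ->
  (forall u : R, s <= u <= t -> dh u <= dG u) ->
  h t - h s <= G t - G s.
Proof.
move=> st hh hG le_hG.
have hB (u : R) : s <= u <= t -> is_derive u 1 (h - G) (dh u - dG u).
  by move=> su; apply: is_deriveB; [exact: hh|exact: hG].
have [||u ust] := @MVT R (h - G) (fun u => dh u - dG u) s t st.
- by move=> u; rewrite in_itv/= => /andP[su ut]; apply: hB; rewrite !ltW.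
- apply: derivable_within_continuous => u; rewrite in_itv/= => su.
  by have [] := hB _ su.
rewrite !fctE => E.
have su : s <= u <= t by move: ust; rewrite in_itv/= => /andP[? ?]; rewrite !ltW.
rewrite -subr_le0 (_ : _ - _ = h t - G t - (h s - G s)); last by lra.
by rewrite E; apply: mulr_le0_ge0; rewrite ?subr_le0 ?le_hG// subr_ge0 ltW.
Qed.

(** The solution phi equal to 1 at time 0 generates all the others. Propagating
    it backwards, 1 = Phi(0,t) phi(t), shows that it never vanishes. *)
Lemma evolution_operator_fundamental (R : realType) (a : R -> R)
    (Phi : R -> R -> R) : evolution_operator a Phi ->
  exists phi : R -> R, [/\ solves (fun t y => - a t * y) phi,
    forall t : R, 0 <= t -> phi t != 0
    & forall t tau : R, 0 <= t -> 0 <= tau -> Phi t tau = phi t / phi tau].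
Proof.
move=> [ex propagate]; have [phi [phi_sol phi0]] := ex 0 1 (lexx 0).
have phi_neq0 (t : R) : 0 <= t -> phi t != 0.
  move=> t0; apply/eqP => phit0.
  have := propagate _ phi_sol 0 t (lexx 0) t0.
  by rewrite phi0 phit0 mulr0 => /eqP; rewrite oner_eq0.
exists phi; split => // t tau t0 tau0.
by rewrite (propagate _ phi_sol t tau)// mulfK ?phi_neq0.
Qed.

(** The derivative is written with the logarithmic derivative m'/m as a factor,
    the form in which a lower bound m'/m >= 1 can be used. *)
Lemma is_derive_scaled_powR (R : realType) (m : R -> R) (alpha k u : R) :
  0 < m u -> derivable m u 1 -> alpha != 0 ->
  is_derive u 1 (fun v => k / alpha * m v `^ alpha)
    (k * (m u `^ alpha * (derive1 m u / m u))).
Proof.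
move=> mu0 dm alpha0.
have Hm : is_derive u 1 m (derive1 m u).
  by rewrite derive1E; apply: DeriveDef.
have HP := is_derive1_powR alpha mu0.
have H := @is_derive1_comp _ (fun x : R => x `^ alpha) m u _ _ HP Hm.
have := @is_deriveZ _ _ _ _ (k / alpha) _ _ _ H.
rewrite (_ : _ *: _ = k * (m u `^ alpha * (derive1 m u / m u))).
  by apply.
rewrite /GRing.scale/=.
have -> : m u `^ (alpha - 1) = m u `^ alpha / m u.
  by rewrite powRB ?powRr1 ?ltW// (gt_eqF mu0) implybT.
field.
by rewrite alpha0 gt_eqF.
Qed.

(** For fixed t, the derivative of h(tau) = Phi(t,tau) w(tau) is
    Phi(t,tau) g(tau,w(tau)), because tau |-> Phi(t,tau) solves the adjoint
    equation. As m'/m >= 1, it is at most the derivative of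
    G(tau) = (D B / alpha) (m(tau)/m(t))^alpha. So h(t) - h(s) <= G(t) - G(s)
    <= D B / alpha for s in ]0,t[. As s tends to 0 only h has to pass to the
    limit, because G(s) >= 0 has already been discarded. *)
Lemma perturbed_solution_le (R : realType) (a : R -> R) (Phi : R -> R -> R)
    (g : R -> R -> R) (w m : R -> R) (alpha D B t : R) :
  0 < alpha -> 0 < D -> 0 < B ->
  (forall u : R, 0 <= u -> 0 < m u) ->
  (forall u : R, 0 < u -> derivable m u 1 /\ 1 <= derive1 m u * (m u)^-1) ->
  evolution_operator a Phi ->
  (forall tau : R, 0 <= tau <= t -> `|Phi t tau| <= D * (m tau / m t) `^ alpha) ->
  solves (fun u v => - a u * v + g u v) w ->
  (forall u : R, 0 <= u -> `|g u (w u)| <= B) ->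
  0 < t ->
  w t <= D * (m 0 / m t) `^ alpha * `|w 0| + D * B / alpha.
Proof.
move=> alpha0 D0 B0 m0 dm evol Phi_le [w0 dw] gB t0.
have [phi [[phi_cvg0 dphi] phi_neq0 PhiE]] := evolution_operator_fundamental evol.
pose h u := phi t * (w u / phi u).
pose k := B * D / m t `^ alpha.
pose G u := k / alpha * m u `^ alpha.
have mt0 : 0 < m t by apply: m0; exact: ltW.
have k0 : 0 < k by rewrite divr_gt0 ?mulr_gt0 ?powR_gt0.
have dh (u : R) : 0 < u -> is_derive u 1 h (Phi t u * g u (w u)).
  move=> u0; have pn : phi u != 0 by apply/phi_neq0/ltW.
  have Hi := @is_deriveV _ phi u _ _ pn (dphi u u0).
  have HM := @is_deriveM _ _ _ _ _ _ _ _ (dw u u0) Hi.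
  have := @is_deriveZ _ _ _ _ (phi t) _ _ _ HM.
  rewrite (_ : _ *: _ = Phi t u * g u (w u)); first by apply.
  rewrite /GRing.scale/= PhiE ?ltW//.
  by rewrite /GRing.scale/= expr2; field.
have dG (u : R) : 0 < u -> is_derive u 1 G (k * (m u `^ alpha * (derive1 m u / m u))).
  by move=> u0; apply: is_derive_scaled_powR;
    rewrite ?gt_eqF ?m0 ?ltW//; have [] := dm _ u0.
(* The equations hold only at positive times, hence the lower end s > 0. *)
have hG (s : R) : 0 < s -> s < t -> h t <= h s + D * B / alpha.
  move=> s0 st.
  have : h t - h s <= G t - G s.
    apply: (@le_increment _ h (fun u => Phi t u * g u (w u)) G (fun u => k * (m u `^ alpha * (derive1 m u / m u))) _ _ st) => u /andP[su ut].
    - by apply: dh; exact: lt_le_trans su.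
    - by apply: dG; exact: lt_le_trans su.
    have u0 := lt_le_trans s0 su.
    have mu0 := m0 u (ltW u0).
    apply: (le_trans (ler_norm _)); rewrite normrM.
    apply: (@le_trans _ _ (D * (m u / m t) `^ alpha * B)).
      by apply: ler_pM => //; [apply: Phi_le; rewrite ltW|apply: gB; exact: ltW].
    have -> : (m u / m t) `^ alpha = m u `^ alpha / m t `^ alpha.
      by rewrite powRM ?invr_ge0 ?ltW// -powR_inv1 ?ltW// -powRrM mulN1r powRN.
    rewrite (_ : _ * B = k * m u `^ alpha); last by rewrite /k; ring.
    rewrite ler_pM2l// ler_peMr ?powR_ge0//.
    by have [] := dm _ u0.
  have -> : G t = D * B / alpha.
    by rewrite /G /k; field; rewrite !gt_eqF ?powR_gt0.
  have : 0 <= G s by rewrite mulr_ge0 ?powR_ge0// divr_ge0 ?ltW.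
  lra.
(* The inequality extends to s = 0 because h is right-continuous there. *)
have h_cvg0 : h u @[u --> 0^'+] --> h 0.
  apply: cvgM; first exact: cvg_cst.
  apply: cvgM => //; apply: cvgV => //; exact: phi_neq0.
have ht : h t = w t by rewrite /h; field; apply: phi_neq0; exact: ltW.
have -> : w t = h t by [].
have h0le : h t - D * B / alpha <= h 0.
  apply: (@ler_cvg_to _ 0^'+ _ _ (cst (h t - D * B / alpha)) h) => //.
    exact: cvg_cst.
  near=> s.
  by rewrite /cst lerBlDr; apply: hG; near: s;
    [exact: nbhs_right_gt|exact: nbhs_right_lt].
have : h 0 <= D * (m 0 / m t) `^ alpha * `|w 0|.
  rewrite (_ : h 0 = Phi t 0 * w 0); last by rewrite /h PhiE ?(ltW t0)//; ring.
  apply: (le_trans (ler_norm _)); rewrite normrM ler_wpM2r//.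
  by apply: Phi_le; rewrite lexx ltW.
lra.
Unshelve. all: by end_near.
Qed.

(** * Decay of the gauge *)

Lemma cocycle_ratio (R : realType) (nu : R -> R -> R) :
  (forall t tau : R, 0 <= t -> 0 <= tau -> 0 < nu t tau) ->
  (forall t tau s : R, 0 <= t -> 0 <= tau -> 0 <= s ->
     nu t tau * nu tau s = nu t s) ->
  forall t tau : R, 0 <= t -> 0 <= tau -> nu t tau = nu 0 tau / nu 0 t.
Proof.
move=> nu0 coc t tau t0 tau0.
by rewrite -(coc 0 t tau)// mulrAC mulfV ?mul1r// gt_eqF// nu0.
Qed.

(** Monotonicity of t |-> nu t 0 = 1 / m(t), with m = nu 0, gives m >= 1 on
    [0, +oo[; then m' >= m >= 1 makes m strictly increasing at positive
    times. *)
Lemma gauge_lt1 (R : realType) (nu : R -> R -> R) (t : R) :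
  (forall t tau : R, 0 <= t -> 0 <= tau -> 0 < nu t tau) ->
  (forall t tau s : R, 0 <= t -> 0 <= tau -> 0 <= s ->
     nu t tau * nu tau s = nu t s) ->
  (forall t t' : R, 0 <= t -> t <= t' -> nu t' 0 <= nu t 0) ->
  (forall u : R, 0 < u -> derivable (nu 0) u 1 /\
     1 <= derive1 (nu 0) u * (nu 0 u)^-1) ->
  0 < t -> nu t 0 < 1.
Proof.
move=> nu0 coc decr dnu t0.
have ratio := cocycle_ratio nu0 coc.
have nu00 : nu 0 0 = 1 by rewrite ratio// mulfV// gt_eqF// nu0.
have nu_ge1 (u : R) : 0 <= u -> 1 <= nu 0 u.
  move=> u0; have := decr _ _ (lexx 0) u0.
  by rewrite (ratio u 0)// nu00 ler_pdivrMr ?nu0// mul1r.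
have t2 : 0 < t / 2 by rewrite divr_gt0.
have t2t : t / 2 < t by lra.
(* Starting from t / 2 avoids time 0, where nu 0 need not be differentiable. *)
have grow : t - t / 2 <= nu 0 t - nu 0 (t / 2).
  apply: (@le_increment _ id (cst 1) (nu 0) (derive1 (nu 0)) _ _ t2t).
  - move=> u /andP[u2 _]; rewrite derive1E; apply: DeriveDef => //.
    by have [] := dnu u (lt_le_trans t2 u2).
  - move=> u /andP[u2 _]; have u0 := lt_le_trans t2 u2.
    have [_] := dnu u u0; rewrite ler_pdivlMr ?nu0 ?(ltW u0)// mul1r.
    by apply: le_trans; apply: nu_ge1; exact: ltW.
rewrite ratio ?(ltW t0)// nu00 ltr_pdivrMr ?nu0 ?(ltW t0)// mul1r.
by have := nu_ge1 _ (ltW t2); lra.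
Qed.

Lemma powR_cvgy0 (R : realType) (q : R) : 0 < q -> q < 1 ->
  q `^ alpha @[alpha --> +oo] --> (0 : R).
Proof.
move=> q0 q1.
have -> : (fun alpha : R => q `^ alpha) =
    (fun x : R => expR (- x)) \o (fun alpha : R => alpha * - ln q).
  by apply/funext => alpha /=; rewrite /powR gt_eqF// mulrN opprK.
apply: (@cvg_comp _ _ _ _ _ _ (pinfty_nbhs R)); last exact: cvgr_expR.
by apply: gt0_cvgMly; [rewrite oppr_gt0 ln_lt0// q0|exact: cvg_id].
Qed.

(** * Distance to a Euclidean ball *)

Lemma enorm_ge0 (R : realType) (n : nat) (x : 'rV[R]_n) : 0 <= enorm x.
Proof. exact: sqrtr_ge0. Qed.

Lemma enormZ (R : realType) (n : nat) (k : R) (x : 'rV[R]_n) :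
  enorm (k *: x) = `|k| * enorm x.
Proof.
rewrite /enorm -sqrtr_sqr -sqrtrM ?sqr_ge0// mulr_sumr.
by congr Num.sqrt; apply: eq_bigr => i _; rewrite mxE exprMn.
Qed.

Definition eball (R : realType) (n : nat) (r : R) : set 'rV[R]_n :=
  [set y | enorm y <= r].
Arguments eball {R} n r.

Lemma coord_le_enorm (R : realType) (n : nat) (x : 'rV[R]_n) (j : 'I_n) :
  `|x 0 j| <= enorm x.
Proof.
rewrite -sqrtr_sqr ler_wsqrtr// (bigD1 j)//= lerDl.
by apply: sumr_ge0 => i _; exact: sqr_ge0.
Qed.

Lemma bounded_eball (R : realType) (n : nat) (r : R) : bounded_set (eball n r).
Proof.
exists `|r|; split; first exact: num_real.
move=> B rB x /= xr; rewrite /Num.norm/= mx_normrE.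
have B0 : 0 <= B by rewrite ltW// (le_lt_trans _ rB).
apply/bigmax_leP; split => //= -[i j] _ /=; rewrite (ord1 i).
apply: (le_trans (coord_le_enorm x j)); apply: (le_trans xr).
by apply: ltW; apply: le_lt_trans rB; exact: ler_norm.
Qed.

Lemma nbhs0_eball (R : realType) (n : nat) (r : R) : 0 < r ->
  nbhs (0 : 'rV[R]_n) (eball n r).
Proof.
(* A sup-norm ball of radius e fits since n e^2 <= (n + 1)^2 e^2 = r^2; using
   n + 1 also covers n = 0. *)
move=> r0; pose e := r / n.+1%:R.
have e0 : 0 < e by rewrite divr_gt0.
apply/nbhs_ballP; exists e => //= y [_ ye]; rewrite /eball/=.
have ye2 (i : 'I_n) : y 0 i ^+ 2 <= e ^+ 2.
  have := ye 0 i; rewrite /ball/= mxE sub0r normrN => /ltW yie.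
  by rewrite -[leLHS]real_normK ?num_real// lerXn2r ?nnegrE ?normr_ge0 ?(ltW e0).
rewrite /enorm -(ger0_norm (ltW r0)) -sqrtr_sqr ler_wsqrtr//.
apply: (@le_trans _ _ (\sum_(i < n) e ^+ 2)); first exact: ler_sum.
rewrite sumr_const card_ord -mulr_natl.
have -> : r ^+ 2 = n.+1%:R ^+ 2 * e ^+ 2.
  by rewrite -exprMn mulrC divfK ?pnatr_eq0.
rewrite ler_pM2r ?exprn_gt0// -natrX ler_nat.
by rewrite (leq_trans (leqnSn n))// -[leqLHS]expn1 leq_pexp2l.
Qed.

(** Outside the ball, the radial projection (r / |x|) x realizes the distance
    |x| - r. *)
Lemma dist_eball (R : realType) (n : nat) (r e : R) (x : 'rV[R]_n) :
  0 <= r -> 0 <= e -> enorm x <= r + e -> 0 <= dist x (eball n r) <= e.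
Proof.
move=> r0 e0 xre; rewrite /dist; set S := [set _ | _ in _].
have S_ge0 : lbound S 0 by move=> _ [y _ <-]; exact: enorm_ge0.
suff [z Sz ze] : exists2 z, S z & z <= e.
  apply/andP; split; first by apply: lb_le_inf => //; exists z.
  by apply: le_trans ze; apply: ge_inf => //; exists 0.
have [xr|rx] := leP (enorm x) r.
  exists 0 => //; exists x => //.
  by rewrite subrr -(scale0r x) enormZ normr0 mul0r.
have x0 : 0 < enorm x by exact: le_lt_trans rx.
pose k := r / enorm x.
have k0 : 0 <= k by rewrite divr_ge0 // ltW.
have k1 : k <= 1 by rewrite ler_pdivrMr// mul1r ltW.
exists (enorm (x - k *: x)).
  by exists (k *: x) => //=; rewrite /eball/= enormZ ger0_norm// divfK// gt_eqF.
rewrite -[X in X - _]scale1r -scalerBl enormZ ger0_norm ?subr_ge0//.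
by rewrite mulrBl mul1r divfK ?gt_eqF// lerBlDl.
Qed.

Lemma approximately_converges_eball (R : realType) (n : nat) (tp r : R)
    (b : R -> R) (x : R -> 'rV[R]_n) : 0 <= r ->
  (forall t : R, tp <= t -> 0 <= b t) ->
  (forall t : R, tp <= t -> enorm (x t) <= r + b t) ->
  (forall t : R, tp <= t -> b t <= b tp) ->
  b t @[t --> +oo] --> (0 : R) ->
  approximately_converges tp (eball n r) (b tp) x.
Proof.
move=> r0 b0 xb bdecr bcvg.
have d_le (t : R) : tp <= t -> 0 <= dist (x t) (eball n r) <= b t.
  by move=> tt; apply: dist_eball => //; [exact: b0|exact: xb].
have d_tp (t : R) : tp <= t -> dist (x t) (eball n r) <= b tp.
  by move=> tt; have /andP[_ /le_trans] := d_le t tt; apply; exact: bdecr.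
split => //.
  (* The bound holds on all of ]tp, +oo[, one of the sets over which the
     infimum is taken. *)
  rewrite limf_esupE; apply: ge_ereal_inf.
  exists (ereal_sup [set (dist (x t) (eball n r))%:E | t in `]tp, +oo[]).
    exists `]tp, +oo[%classic => //; near=> t.
    by rewrite /= in_itv/= andbT; near: t; exact: nbhs_right_gt.
  apply: ge_ereal_sup => _ [t /= + <-]; rewrite in_itv/= andbT => /ltW tt.
  by rewrite lee_fin d_tp.
apply: (@squeeze_cvgr _ _ _ _ (cst 0) b) => //; last exact: cvg_cst.
near=> t; apply: d_le; near: t; apply: nbhs_pinfty_ge; exact: num_real.
Unshelve. all: by end_near. Qed.

(** * Predefined-time convergence *)

Theorem theorem5 (R : realType) (n : nat)
    (tp : R) (htp : 0 < tp)
    (* admissible parameters alpha, and D *)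
    (P : set R) (hP : forall alpha, P alpha -> 0 < alpha)
    (D : R) (hD : 0 < D)
    (* the bound mu_{alpha,D}(t,tau) *)
    (mu : R -> R -> R -> R -> R)
    (hmu : forall alpha D' t tau : R, 0 < alpha -> 0 < D' -> 0 <= t -> 0 <= tau ->
             0 < mu alpha D' t tau)
    (hB1 : B1 mu)
    (eps0 : R) (heps0 : 0 < eps0)
    (hB2 : forall alpha, P alpha -> B2 tp mu alpha D eps0)
    (hB3 : B3 mu)
    (* the time-base generator A(t,tp) with parameter alpha *)
    (A : R -> R -> R) (Phi : R -> R -> R -> R)
    (hPhi : forall alpha, P alpha -> evolution_operator (A alpha) (Phi alpha))
    (hPhimu : forall alpha t tau : R, P alpha -> 0 <= tau -> tau <= t ->
                `|Phi alpha t tau| <= mu alpha D t tau)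
    (f : 'rV[R]_n -> 'rV[R]_n) (hf : f 0 = 0)
    (* the Lyapunov function *)
    (V : 'rV[R]_n -> R) (c : R) (hc : 0 < c)
    (hV : forall y, c * enorm y ^+ 2 <= V y)
    (F : R -> R -> R -> R)
    (hF : forall alpha, P alpha ->
            {within [set p : R * R | 0 <= p.1],
               continuous (fun p : R * R => F alpha p.1 p.2)})
    (M : R -> R) (hM : forall alpha, P alpha -> 0 < M alpha)
    (hVF : forall alpha (x : R -> 'rV[R]_n), P alpha ->
             solves (fun t y => - A alpha t *: f y) x ->
             solves (fun t v => - A alpha t * v + F alpha t v)
                    (fun t => V (x t)) /\
             (forall t : R, 0 <= t -> `|F alpha t (V (x t))| <= M alpha)) :
  let system alpha t (y : 'rV[R]_n) := - A alpha t *: f y in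
  exists eps : R -> 'rV[R]_n -> R,
    (* each fixed alpha, with accuracy eps alpha x0 *)
    (forall alpha, P alpha ->
       predefined_time_approx_convergence tp 0 [set alpha] system eps) /\
    (* a common neighbourhood for all alpha when M alpha = O(alpha) *)
    ((exists K : R, forall alpha, P alpha -> M alpha <= K * alpha) ->
       predefined_time_approx_convergence tp 0 P system eps).
Proof.
move=> system.
have [B1_lim B1_decr _ _] := hB1.
have [B3_powR B3_coc B3_der] := hB3.
pose nu := mu 1 1.
have nu0 (t tau : R) : 0 <= t -> 0 <= tau -> 0 < nu t tau by exact: hmu.
have ratio := cocycle_ratio nu0 B3_coc.
pose q := nu tp 0.
have q0 : 0 < q by apply: nu0 => //; exact: ltW.
have q1 : q < 1.
  by apply: gauge_lt1 => // t t' t0 tt'; apply: B1_decr.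
have V0 y : 0 <= V y.
  by apply: le_trans (hV y); rewrite mulr_ge0 ?sqr_ge0// ltW.
(* The summand 1 keeps the accuracy positive when V x0 = 0. *)
pose acc (d : R) (x0 : 'rV[R]_n) := Num.sqrt (d * ((V x0 + 1) / c)).
have Vc0 x0 : 0 < (V x0 + 1) / c by rewrite divr_gt0// ltr_wpDl.
pose eps alpha (x0 : 'rV[R]_n) := acc (D * q `^ alpha) x0.
have eps_gt0 alpha x0 : 0 < eps alpha x0.
  by rewrite sqrtr_gt0 mulr_gt0 ?Vc0// mulr_gt0 ?powR_gt0.
have eps_lim x0 : eps alpha x0 @[alpha --> +oo] --> (0 : R).
  have -> : (0 : R) = Num.sqrt (D * 0 * ((V x0 + 1) / c)).
    by rewrite mulr0 mul0r sqrtr0.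
  apply: continuous_cvg; first exact: sqrt_continuous.
  apply: cvgM; last exact: cvg_cst.
  by apply: cvgM; [exact: cvg_cst|exact: powR_cvgy0].
have epsE alpha x0 : P alpha -> eps alpha x0 = acc (mu alpha D tp 0) x0.
  by move=> Pa; rewrite /eps B3_powR ?(hP _ Pa) ?(ltW htp).
have V_le alpha (x : R -> 'rV[R]_n) (t : R) : P alpha ->
    solves (system alpha) x -> 0 < t ->
    V (x t) <= mu alpha D t 0 * V (x 0) + D * M alpha / alpha.
  move=> Pa xsol t0; have [Vsol FM] := hVF _ _ Pa xsol.
  have := @perturbed_solution_le R (A alpha) (Phi alpha) (F alpha)
    (fun u => V (x u)) (nu 0) alpha D (M alpha) t.
  rewrite -ratio ?(ltW t0)// -B3_powR ?(hP _ Pa) ?(ltW t0)// (ger0_norm (V0 _)).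
  apply => //; [exact: hM|by move=> u u0; exact: nu0|exact: hPhi|].
  move=> tau /andP[tau0 taut]; rewrite -ratio ?(ltW t0)// -B3_powR ?(hP _ Pa) ?(ltW t0)//.
  exact: hPhimu.
suff main (Q : set R) (K : R) : Q `<=` P -> 0 < K ->
    (forall alpha, Q alpha -> M alpha <= K * alpha) ->
    predefined_time_approx_convergence tp 0 Q system eps.
  (* For P empty, K could be nonpositive; |K| + 1 is always a positive bound. *)
  exists eps; split=> [alpha Pa|[K MK]].
    apply: (@main _ (M alpha / alpha)) => [_ ->//||_ ->].
      by rewrite divr_gt0 ?hM ?hP.
    by rewrite divfK// gt_eqF// hP.
  apply: (@main _ (`|K| + 1)) => [//||alpha Pa].
    by rewrite ltr_wpDl.
  apply: (le_trans (MK _ Pa)); rewrite ler_pM2r ?hP//.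
  by rewrite (le_trans (ler_norm K))// lerDl.
move=> QP K0 MK; pose r := Num.sqrt (D * K / c).
have r0 : 0 < r by rewrite sqrtr_gt0 divr_gt0 ?mulr_gt0.
exists (eball n r); split; [exact: bounded_eball|exact: nbhs0_eball|].
move=> x0; split => // alpha x /[dup] Qa /QP Pa xsol xx0.
have a0 := hP _ Pa.
rewrite epsE//; apply: (@approximately_converges_eball _ _ tp r
    (fun t => acc (mu alpha D t 0) x0)).
- exact: ltW.
- by move=> t _; exact: sqrtr_ge0.
- move=> t tpt; have t0 := lt_le_trans htp tpt.
  set b := acc _ _; have b0 : 0 <= b by exact: sqrtr_ge0.
  have mut0 : 0 < mu alpha D t 0 by rewrite hmu// ltW.
  have b2 : b ^+ 2 = mu alpha D t 0 * ((V x0 + 1) / c).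
    by rewrite sqr_sqrtr// mulr_ge0// ltW.
  have r2 : r ^+ 2 = D * K / c by rewrite sqr_sqrtr// divr_ge0 ?mulr_ge0// ltW.
  (* From |x|^2 <= r^2 + b^2 one gets |x| <= r + b. *)
  suff E2 : enorm (x t) ^+ 2 <= r ^+ 2 + b ^+ 2.
    rewrite -ler_sqr ?nnegrE ?enorm_ge0 ?addr_ge0 ?(ltW r0)//.
    apply: (le_trans E2); rewrite sqrrD addrAC lerDl.
    by rewrite mulrn_wge0// mulr_ge0// ltW.
  rewrite b2 r2 mulrA -mulrDl ler_pdivlMr// mulrC.
  apply: (le_trans (hV _)); apply: (le_trans (V_le _ _ _ Pa xsol t0)).
  rewrite xx0 addrC lerD//; last by rewrite ler_pM2l// lerDl.
  by rewrite ler_pdivrMr// -mulrA ler_pM2l// MK.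
- move=> t tpt; rewrite ler_wsqrtr// ler_pM2r//.
  by apply: B1_decr => //; exact: ltW.
- have -> : (0 : R) = Num.sqrt (0 * ((V x0 + 1) / c)) by rewrite mul0r sqrtr0.
  apply: continuous_cvg; first exact: sqrt_continuous.
  by apply: cvgM; [exact: B1_lim|exact: cvg_cst].
Qed.
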